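(* Let $p>0$ and let $w$ and $\omega$ be two weights on $[0,2\pi)$ such that $\log^+(w/\omega)\in L^p$. Then: (i) $L^\omega_p\subset L^w_p$, and $L^\omega_p=L^w_p$ if and only if $\log(w/\omega)\in L^p$. (ii) The topology defined on $L^\omega_p$ by the metric $\rho^\omega_p$ is stronger (i.e. at least as fine) than that induced on $L^\omega_p$ by the metric $\rho^w_p$. (iii) Let $p\ge1$. If $\log(w/\omega)\notin L^p$, then $L^\omega_p$ is a proper subset of $L^w_p$. Furthermore, the topology defined on $L^\omega_p$ by the metric $\rho^\omega_p$ is strictly stronger than that induced on $L^\omega_p$ by the metric $\rho^w_p$. (iv) Let $p\ge1$. If $(L^\omega_p,\rho^w_p)$ is a complete metric space, then $\log(w/\omega)\in L^p$, and the topology defined on $L^\omega_p=L^w_p$ by the metric $\rho^\omega_p$ coincides with that induced on $L^\omega_p$ by the metric $\rho^w_p$.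
   Context: A weight is a Lebesgue measurable function $w:[0,2\pi)\to[0,\infty)$ with $w(t)>0$ for almost every $t$. $L^p$ is the Lebesgue space $L^p([0,2\pi),dt/2\pi)$, and $\log^+a=\max\{\log a,0\}$. For $p>0$ and a weight $w$, $L^w_p$ is the class of all (a.e.-equivalence classes of) complex-valued measurable functions $f$ on $[0,2\pi)$ with $$(\|f\|^w_p)^p:=\int_0^{2\pi}(\log(1+|f(t)|w(t)))^p\,\frac{dt}{2\pi}<\infty,$$ with the translation invariant metric $\rho^w_p(f,g)=(\|f-g\|^w_p)^{\min\{p,1\}}$. *)

(* Defs.v *)
From HB Require Import structures.
From mathcomp Require Import all_boot all_order all_algebra.
From mathcomp Require Import generic_quotient complex.
From mathcomp Require Import all_classical all_reals all_analysis.
From mathcomp Require Import measurable_realfun ring lra.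

Set Implicit Arguments.
Unset Strict Implicit.
Unset Printing Implicit Defensive.

Import Order.TTheory GRing.Theory Num.Theory.
Import numFieldTopology.Exports.

Local Open Scope classical_set_scope.
Local Open Scope ring_scope.
Local Open Scope quotient_scope.

Section pow_gauge.
Local Open Scope ereal_scope.
Context d (T : measurableType d) (R : realType).
Variables (mu : {measure set T -> \bar R}) (D : set T) (mD : measurable D).
Variables (p : R) (p0 : (0 < p)%R).

Let lepowRD (a b : R) : (0 <= a -> 0 <= b -> p <= 1 ->
  (a + b) `^ p <= a `^ p + b `^ p)%R.
Proof.
move=> a0 b0 p1; have := addr_ge0 a0 b0; rewrite le_eqVlt => /predU1P[s0|s0].
  by rewrite -s0 powR0 ?(gt_eqF p0)// addr_ge0// powR_ge0.
have key c : (0 <= c -> c <= a + b ->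
    c / (a + b) * (a + b) `^ p <= c `^ p)%R.
  move=> c0 cs; have [->|cn0] := eqVneq c 0%R.
    by rewrite !mul0r powR_ge0.
  rewrite -[in leRHS](divfK (lt0r_neq0 s0) c).
  rewrite powRM ?(divr_ge0 c0 (ltW s0)) ?(ltW s0)//.
  rewrite ler_wpM2r ?powR_ge0//.
  have q0 : (0 < c / (a + b))%R by rewrite divr_gt0// lt0r cn0.
  rewrite -[X in (X <= _)%R]powRr1 ?(ltW q0)//.
  by rewrite (ger_powR _ p1)// q0 ler_pdivrMr// mul1r.
have := lerD (key a a0 _) (key b b0 _).
rewrite -mulrDl -mulrDl (divff (lt0r_neq0 s0)) mul1r; apply.
  by rewrite lerDl.
by rewrite lerDr.
Qed.

Definition pow_gauge (a : T -> R) :=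
  ((\int[mu]_(t in D) (a t `^ p)%:E) `^ p^-1) `^ Num.min p 1%R.

Lemma measurable_pow (a : T -> R) : measurable_fun D a ->
  measurable_fun D (EFin \o (fun t => a t `^ p)%R).
Proof.
move=> ma; apply/measurable_EFinP.
exact: (measurableT_comp (measurable_powR p) ma).
Qed.

Lemma le_pow_gauge (a b c : T -> R) :
  measurable_fun D a -> measurable_fun D b -> measurable_fun D c ->
  (forall t, D t -> (0 <= a t)%R) -> (forall t, D t -> (0 <= b t)%R) ->
  (forall t, D t -> (0 <= c t)%R) ->
  (forall t, D t -> (c t <= a t + b t)%R) ->
  pow_gauge c <= pow_gauge a + pow_gauge b.
Proof.
move=> ma mb mc a0 b0 c0 cab.
have intge0 (u : T -> R) : 0 <= \int[mu]_(t in D) (u t `^ p)%:E.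
  by apply: integral_ge0 => t _; rewrite lee_fin powR_ge0.
have le1 (x y z : \bar R) : (p <= 1)%R -> 0 <= x -> 0 <= y -> 0 <= z ->
    z <= x + y -> (z `^ p^-1) `^ Num.min p 1%R <=
      (x `^ p^-1) `^ Num.min p 1%R + (y `^ p^-1) `^ Num.min p 1%R.
  move=> p1 x0 y0 z0; rewrite min_l// -!poweRrM (mulVf (lt0r_neq0 p0)).
  by rewrite !poweRe1.
have lt1 (x y z : \bar R) : (1 < p)%R -> z `^ p^-1 <= x `^ p^-1 + y `^ p^-1 ->
    (z `^ p^-1) `^ Num.min p 1%R <=
      (x `^ p^-1) `^ Num.min p 1%R + (y `^ p^-1) `^ Num.min p 1%R.
  by move=> p1; rewrite min_r ?(ltW p1)// !poweRe1 ?poweR_ge0.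
rewrite /pow_gauge; have [p1|] := boolP (p <= 1)%R.
  apply: (le1 _ _ _ p1 (intge0 a) (intge0 b) (intge0 c)).
  rewrite -(ge0_integralD mu mD); first last.
  - exact: measurable_pow.
  - by move=> t _; rewrite lee_fin powR_ge0.
  - exact: measurable_pow.
  - by move=> t _; rewrite lee_fin powR_ge0.
  apply: (ge0_le_integral mu mD).
  - by move=> t _; rewrite lee_fin powR_ge0.
  - exact: measurable_pow.
  - by apply: emeasurable_funD; exact: measurable_pow.
  - move=> t Dt; rewrite -EFinD lee_fin; apply: le_trans (lepowRD _ _ p1).
    + apply: (ge0_ler_powR (ltW p0)); rewrite ?nnegrE ?c0//.
      * by rewrite addr_ge0 ?a0 ?b0.
      * exact: cab.
    + exact: a0.
    + exact: b0.
rewrite -ltNge => p1; apply: (lt1 _ _ _ p1).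
have NE (u : T -> R) : (forall t, D t -> (0 <= u t)%R) ->
    (\int[mu]_(t in D) (u t `^ p)%:E) `^ p^-1 =
    'N[mu]_p%:E[EFin \o (u \_ D)].
  move=> u0; rewrite unlock /Lnorm.body; congr (_ `^ _).
  rewrite [LHS]integral_mkcond; apply: eq_integral => t _.
  rewrite /= !patchE; case: ifPn => [/set_mem Dt|_].
    by rewrite ger0_norm// u0.
  by rewrite /= normr0 powR0// gt_eqF.
have mr (u : T -> R) : measurable_fun D u -> measurable_fun [set: T] (u \_ D).
  by move=> md; apply/(measurable_restrict u mD measurableT); rewrite setTI.
have abD : (fun t => a t + b t)%R \_ D = (a \_ D \+ b \_ D)%R.
  by apply/funext => t /=; rewrite !patchE; case: ifP => // _; rewrite addr0.
have mono (x y : \bar R) : 0 <= x -> x <= y -> x `^ p^-1 <= y `^ p^-1.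
  move=> x0 xy; rewrite gt0_ler_poweR ?invr_ge0 ?(ltW p0)//.
    by rewrite in_itv/= x0 leey.
  by rewrite in_itv/= (le_trans x0 xy) leey.
apply: (@le_trans _ _
    ((\int[mu]_(t in D) ((a t + b t) `^ p)%:E) `^ p^-1)).
  apply: (mono _ _ (intge0 c)).
  apply: (ge0_le_integral mu mD).
  - by move=> t _; rewrite lee_fin powR_ge0.
  - exact: measurable_pow.
  - by apply: measurable_pow; exact: measurable_funD.
  - move=> t Dt; rewrite lee_fin.
    apply: (ge0_ler_powR (ltW p0)); rewrite ?nnegrE ?c0//.
      by rewrite addr_ge0 ?a0 ?b0.
    exact: cab.
have ab0 t : D t -> (0 <= a t + b t)%R
  by move=> Dt; rewrite addr_ge0 ?a0 ?b0.
rewrite (NE _ a0) (NE _ b0) (NE _ ab0) abD.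
exact: (minkowski_EFin mu (mr _ ma) (mr _ mb) (ltW p1)).
Qed.

End pow_gauge.

(* The real line with the sigma-algebra of Lebesgue (not only Borel) measurable
   sets. Functions on [0, 2pi) are functions on the line considered only through
   their values on [circle]. *)
Definition lebT (R : realType) := caratheodory_type (@wlength R idfun)^*%mu.

Definition circle (R : realType) : set (lebT R) := `[0, 2 * pi[%classic.
Arguments circle : clear implicits.

Fact inv2pi_ge0 (R : realType) : 0 <= (2 * pi)^-1 :> R.
Proof. by rewrite invr_ge0 mulr_ge0// pi_ge0. Qed.

(* dt / 2pi *)
Definition dt2pi (R : realType) : {measure set (lebT R) -> \bar R} :=
  mscale (NngNum (inv2pi_ge0 R)) (@completed_lebesgue_measure R).
Arguments dt2pi : clear implicits.

Definition cmod (R : realType) (z : R[i]) : R := complex.Re `|z|.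

Definition cmeasurable (R : realType) (f : lebT R -> R[i]) : Prop :=
  measurable_fun (circle R) (fun t => complex.Re (f t)) /\
  measurable_fun (circle R) (fun t => complex.Im (f t)).

Record weight (R : realType) := Weight {
  weight_fun :> lebT R -> R ;
  weight_measurable : measurable_fun (circle R) weight_fun ;
  weight_ge0 : forall t, circle R t -> 0 <= weight_fun t ;
  weight_gt0 : {ae dt2pi R, forall t, circle R t -> 0 < weight_fun t} }.

Definition inLp (R : realType) (p : R) (g : lebT R -> R) : Prop :=
  measurable_fun (circle R) g /\
  (\int[dt2pi R]_(t in circle R) (`|g t| `^ p)%:E < +oo)%E.

(* Complex measurable functions on [0, 2pi) and their a.e.-classes. *)
Definition cfun (R : realType) := set_type (@cmeasurable R).

Definition ae_eqc (R : realType) (f g : cfun R) : bool :=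
  `[< {ae dt2pi R, forall t, circle R t -> val f t = val g t} >].

Section ae_class.
Variable R : realType.

Fact ae_eqc_refl : reflexive (@ae_eqc R).
Proof. by move=> f; apply/asboolP/aeW. Qed.

Fact ae_eqc_sym : symmetric (@ae_eqc R).
Proof.
by move=> f g; apply/idP/idP => /asboolP h; apply/asboolP;
  apply: filterS h => t /[apply].
Qed.

Fact ae_eqc_trans : transitive (@ae_eqc R).
Proof.
move=> g f h /asboolP fg /asboolP gh; apply/asboolP.
by apply: filterS2 fg gh => t fg gh Dt; rewrite fg// gh.
Qed.

Canonical ae_eqc_equiv :=
  EquivRel (@ae_eqc R) ae_eqc_refl ae_eqc_sym ae_eqc_trans.

Definition ae_class := {eq_quot (@ae_eqc R)}.
HB.instance Definition _ := Choice.on ae_class.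
HB.instance Definition _ := EqQuotient.on ae_class.

Definition rep (F : ae_class) : lebT R -> R[i] := val (repr F).

Fact rep_measurable F : cmeasurable (rep F).
Proof. exact: set_valP. Qed.

End ae_class.

Definition logw (R : realType) (w : weight R) (f : lebT R -> R[i])
  (t : lebT R) : R := ln (1 + cmod (f t) * w t).

(* (||f||_p^w)^p; locked only so that comparing two norms does not unfold the
   integral. *)
HB.lock Definition lognormp (R : realType) (p : {posnum R}) (w : weight R)
    (f : lebT R -> R[i]) : \bar R :=
  \int[dt2pi R]_(t in circle R) ((logw w f t) `^ p%:num)%:E.
Canonical locked_lognormp := Unlockable lognormp.unlock.
Arguments lognormp {R} p w f.

Section log_space.
Variables (R : realType) (p : {posnum R}).
Implicit Types (w : weight R) (f g h : lebT R -> R[i]).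

Definition lognorm w f : \bar R := (lognormp p w f `^ p%:num^-1)%E.

Definition Llog w : set (ae_class R) :=
  [set F | (lognormp p w (rep F) < +oo)%E].

Definition rho w (F G : ae_class R) : R :=
  fine (lognorm w (rep F \- rep G)) `^ Num.min p%:num 1%R.

Section triangle.
Local Open Scope ereal_scope.

Let D := circle R.
Let mu := dt2pi R.

Fact measurable_circle : measurable D.
Proof. by apply: sub_caratheodory; exact: measurable_itv. Qed.

Let cmod_ge0 (z : R[i]) : (0 <= cmod z)%R.
Proof. by rewrite /cmod normc_def sqrtr_ge0. Qed.

Let cmodD (x y : R[i]) : (cmod (x + y) <= cmod x + cmod y)%R.
Proof.
have := ler_normD x y.
by rewrite /cmod !normc_def -rmorphD/= lecR.
Qed.

Let cmeasurableB f g : cmeasurable f -> cmeasurable g ->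
  cmeasurable (f \- g)%R.
Proof.
move=> [mf1 mf2] [mg1 mg2]; split.
- rewrite (_ : (fun _ => _) =
    (fun t => complex.Re (f t) - complex.Re (g t)))%R; last first.
    by apply/funext => t /=; case: (f t); case: (g t).
  exact: measurable_funB.
- rewrite (_ : (fun _ => _) =
    (fun t => complex.Im (f t) - complex.Im (g t)))%R; last first.
    by apply/funext => t /=; case: (f t); case: (g t).
  exact: measurable_funB.
Qed.

Let logw_ge0 w f t : D t -> (0 <= logw w f t)%R.
Proof. by move=> Dt; rewrite ln_ge0// lerDl mulr_ge0// weight_ge0. Qed.

Let measurable_logw w f : cmeasurable f -> measurable_fun D (logw w f).
Proof.
move=> [mf1 mf2]; apply: (measurableT_comp (@measurable_ln R)).
apply: measurable_funD; first exact: measurable_cst.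
apply: measurable_funM; last first.
  exact: weight_measurable.
rewrite (_ : (fun _ => _) = (fun t =>
    (complex.Re (f t) ^+ 2 + complex.Im (f t) ^+ 2) `^ 2^-1))%R; last first.
  apply/funext => t; rewrite /cmod normc_def/= powR12_sqrt//.
  by rewrite addr_ge0// sqr_ge0.
apply: (measurableT_comp (measurable_powR _)).
by apply: measurable_funD; exact: measurable_funX.
Qed.

Let logwD w f g h t : D t -> f t = (g t + h t)%R ->
  (logw w f t <= logw w g t + logw w h t)%R.
Proof.
rewrite /logw => Dt ->; have w0 := weight_ge0 w Dt.
rewrite -lnM ?posrE ?ltr_pwDl ?mulr_ge0//.
rewrite ler_ln ?posrE ?mulr_gt0 ?ltr_pwDl ?mulr_ge0//.
have := ler_wpM2r w0 (cmodD (g t) (h t)).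
have := mulr_ge0 (mulr_ge0 (cmod_ge0 (g t)) w0) (mulr_ge0 (cmod_ge0 (h t)) w0).
set x := (_ * w t)%R.
set y := (cmod (g t) * w t)%R; set z := (cmod (h t) * w t)%R.
rewrite mulrDl -/y -/z => yz xyz.
have -> : ((1 + y) * (1 + z) = 1 + (y + z) + y * z)%R by ring.
by rewrite -addrA lerD2l ler_wpDr.
Qed.

Lemma lognorm_triangle w f g h :
  cmeasurable f -> cmeasurable g -> cmeasurable h ->
  lognorm w (f \- h)%R `^ Num.min p%:num 1%R <=
  lognorm w (f \- g)%R `^ Num.min p%:num 1%R +
  lognorm w (g \- h)%R `^ Num.min p%:num 1%R.
Proof.
move=> mf mg mh; rewrite /lognorm unlock.
apply: (@le_pow_gauge _ _ R mu D measurable_circle p%:num (gt0 p)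
  (logw w (f \- g)%R) (logw w (g \- h)%R) (logw w (f \- h)%R)).
- exact/measurable_logw/cmeasurableB.
- exact/measurable_logw/cmeasurableB.
- exact/measurable_logw/cmeasurableB.
- exact: logw_ge0.
- exact: logw_ge0.
- exact: logw_ge0.
- by move=> t Dt; apply: logwD => //=; rewrite addrA subrK.
Qed.

Lemma lognormC w f g : lognorm w (f \- g)%R = lognorm w (g \- f)%R.
Proof.
suff E : lognormp p w (f \- g)%R = lognormp p w (g \- f)%R.
  by rewrite /lognorm E.
by rewrite unlock; apply: eq_integral => t _; rewrite /logw /= /cmod distrC.
Qed.

Lemma lognorm_eq0 w f g : cmeasurable f -> cmeasurable g ->
  lognorm w (f \- g)%R = 0 -> {ae mu, forall t, D t -> f t = g t}.
Proof.
move=> mf mg /poweR_eq0_eq0 fg0.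
have : \int[mu]_(t in D)
    `|(EFin \o (fun t => logw w (f \- g)%R t `^ p%:num)%R) t| = 0.
  rewrite -[RHS]fg0; last first.
    by rewrite unlock; apply: integral_ge0 => t _; rewrite lee_fin powR_ge0.
  by rewrite unlock; apply: eq_integral => t _; rewrite /= ger0_norm ?powR_ge0.
move/ae_eq_integral_abs => /(_ measurable_circle).
move=> /(_ (measurable_pow p%:num (measurable_logw w (cmeasurableB mf mg)))).
apply: filterS2 (weight_gt0 w) => t wt + Dt => /(_ Dt) /= [].
move=> /eqP; rewrite powR_eq0 => /andP[/eqP l0 _].
have wt0 := wt Dt.
have : (0 <= cmod (f t - g t)%R * w t)%R by rewrite mulr_ge0// ltW.
rewrite le_eqVlt => /predU1P[/esym/eqP|c0]; last first.
  suff : (0 < logw w (f \- g)%R t)%R by rewrite l0 ltxx.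
  by rewrite ln_gt0// ltrDl.
rewrite mulf_eq0 (gt_eqF wt0) orbF => /eqP c0; apply/eqP.
rewrite -subr_eq0 -normr_eq0.
by move: c0; rewrite /cmod normc_def/= => ->.
Qed.

Lemma lognormp_ae w f g : cmeasurable f -> cmeasurable g ->
  {ae mu, forall t, D t -> f t = g t} -> lognormp p w f = lognormp p w g.
Proof.
move=> mf mg fg; rewrite unlock.
apply: (ge0_ae_eq_integral measurable_circle).
- exact: (measurable_pow p%:num (measurable_logw w mf)).
- exact: (measurable_pow p%:num (measurable_logw w mg)).
- by move=> t _; rewrite lee_fin powR_ge0.
- by move=> t _; rewrite lee_fin powR_ge0.
- by apply: filterS fg => t fg Dt; rewrite /logw fg.
Qed.

Lemma lognormp_pi w (f : cfun R) :
  lognormp p w (rep (\pi_(ae_class R) f)%qT) = lognormp p w (val f).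
Proof.
apply: lognormp_ae; [exact: rep_measurable|exact: set_valP|].
have /eqmodP/asboolP : (\pi_(ae_class R) (repr (\pi_(ae_class R) f)) =
  \pi_(ae_class R) f)%qT by rewrite reprK.
by [].
Qed.

Lemma lognorm_fin w f : lognormp p w f < +oo ->
  lognorm w f `^ Num.min p%:num 1%R \is a fin_num.
Proof.
move=> foo; rewrite ge0_fin_numE ?poweR_ge0//.
by do 2! apply: poweR_lty.
Qed.

End triangle.

Section metric.
Variable w : weight R.
Let m := Num.min p%:num 1.

Let rhoE (F G : ae_class R) : Llog w F -> Llog w G ->
  ((rho w F G)%:E = lognorm w (rep F \- rep G)%R `^ m)%E.
Proof.
move=> wF wG; rewrite /rho -fine_poweR fineK//.
have m0 : cmeasurable (fun=> 0 : R[i]) by split; exact: measurable_cst.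
have f0 (H : ae_class R) : rep H \- (fun=> 0) = rep H.
  by apply/funext => t /=; rewrite subr0.
have aux (x y z : \bar R) : (0 <= x -> x <= y + z ->
    y \is a fin_num -> z \is a fin_num -> x \is a fin_num)%E.
  move=> x0 xyz yf zf; rewrite ge0_fin_numE// (le_lt_trans xyz)//.
  by rewrite ltey_eq fin_numD yf zf.
have := lognorm_triangle w (rep_measurable F) m0 (rep_measurable G).
rewrite (lognormC w (fun=> 0) (rep G)) !f0 => tri.
have hF := @lognorm_fin w (rep F) wF.
have hG := @lognorm_fin w (rep G) wG.
have h0 := poweR_ge0 (lognorm w (rep F \- rep G)%R) (Num.min p%:num 1).
rewrite /m.
exact: aux h0 tri hF hG.
Qed.

Let m_neq0 : m != 0.
Proof. by rewrite /m gt_eqF// lt_min gt0 ltr01. Qed.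

Lemma rho_refl (F : ae_class R) : rho w F F = 0.
Proof.
rewrite /rho /lognorm.
have -> : lognormp p w (rep F \- rep F) = 0%E.
  rewrite unlock integral0_eq// => t _.
  by rewrite /logw /= subrr /cmod normr0 mul0r addr0 ln1 powR0 ?gt_eqF.
by rewrite poweR0r ?invr_eq0 ?gt_eqF//= powR0.
Qed.

Lemma rho_sym (F G : ae_class R) : rho w F G = rho w G F.
Proof. by rewrite /rho lognormC. Qed.

Lemma rho_eq0 (F G : ae_class R) : Llog w F -> Llog w G ->
  rho w F G = 0 -> F = G.
Proof.
move=> wF wG FG0; have := rhoE wF wG; rewrite FG0 => /esym.
move/(poweR_eq0_eq0 (poweR_ge0 _ _)).
move=> /(lognorm_eq0 (rep_measurable F) (rep_measurable G)) FG.
by rewrite -[F]reprK -[G]reprK; apply/eqmodP/asboolP.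
Qed.

Lemma rho_triangle (F G H : ae_class R) : Llog w F -> Llog w G -> Llog w H ->
  rho w F H <= rho w F G + rho w G H.
Proof.
move=> wF wG wH; rewrite -lee_fin EFinD !rhoE//.
by apply: lognorm_triangle; exact: rep_measurable.
Qed.

End metric.
End log_space.

(* The metric space (S, rho_p^w), for a set of classes S on which rho_p^w is
   finite. The inclusion proof only serves to build the metric structure. *)
Definition rho_space (R : realType) (p : {posnum R}) (w : weight R)
  (S : set (ae_class R)) (Sw : S `<=` Llog p w) : Type := set_type S.

Section rho_space.
Variables (R : realType) (p : {posnum R}) (w : weight R).
Variables (S : set (ae_class R)) (Sw : S `<=` Llog p w).

Let X := rho_space Sw.
Let d (x y : X) : R := rho p w (val x) (val y).

HB.instance Definition _ := Choice.on (rho_space Sw).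

Let dxx x : d x x = 0. Proof. exact: rho_refl. Qed.
Let d_eq0 x y : d x y = 0 -> x = y.
Proof. by move=> /rho_eq0 xy; apply/val_inj/xy; exact/Sw/set_valP. Qed.
Let d_sym x y : d x y = d y x. Proof. exact: rho_sym. Qed.
Let d_triangle y x z : d x z <= d x y + d y z.
Proof. by apply: rho_triangle; exact/Sw/set_valP. Qed.

HB.instance Definition _ :=
  isMetric.Build R (rho_space Sw) dxx d_eq0 d_sym d_triangle.

(* The topology of (S, rho_p^w), as a family of subsets of S; for fixed S these
   families have the same type for all weights. *)
Definition rho_topology : set (set (set_type S)) :=
  [set U | open (U : set (rho_space Sw))].

Lemma rho_topologyP (U : set (set_type S)) : rho_topology U <->
  forall x, U x -> exists2 e : R, 0 < e &
    forall y, rho p w (val x) (val y) < e -> U y.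
Proof.
rewrite /rho_topology /= openE; split=> oU x Ux.
  have /nbhs_ballP[e e0 eU] := oU x Ux.
  by exists e => // y xy; apply: eU; rewrite ballEmdist.
have [e e0 eU] := oU x Ux.
by apply/nbhs_ballP; exists e => // y; rewrite ballEmdist => /eU.
Qed.

Definition rho_complete : Prop :=
  forall F : set_system (rho_space Sw), ProperFilter F -> cauchy F ->
    exists x : rho_space Sw, F --> x.

End rho_space.

(* Main.v *)
(* Put b = omega / w, u = log^+ (w / omega) and v = log^+ b.
   Pointwise log (1 + |f| w) <= log (1 + |f| omega) + u, and on {w <= n omega}
   Bernoulli's inequality gives log (1 + |f| w) <= n log (1 + |f| omega); since
   u^p has small integral over {w > n omega} for large n, L^omega_p is
   contained in L^w_p and the inclusion is uniformly continuous.
   Conversely, everything is tested on f = c / w, for which |f| w is constant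
   while |f| omega = c b, and on its truncations f_n to {b <= n}, which always
   lie in L^omega_p. If f belongs to L^omega_p, then v is in L^p. If the
   topologies agree, then the f_n, being uniformly small for rho^w when c is
   small, are bounded for rho^omega, hence f is in L^omega_p by monotone
   convergence. If L^omega_p is complete for rho^w, it contains the rho^w-limit
   f of the f_n. *)
Require Import Defs.
From mathcomp Require Import all_boot all_order all_algebra.
From mathcomp Require Import generic_quotient complex.
From mathcomp Require Import all_classical all_reals all_analysis.
From mathcomp Require Import measurable_realfun lra.
Import Order.TTheory GRing.Theory Num.Theory.
Local Open Scope classical_set_scope.
Local Open Scope ring_scope.

Set Implicit Arguments.
Unset Strict Implicit.

(** * Two elementary inequalities for powers and logarithms *)

Lemma powRD_le (R : realType) (p a b : R) : 0 <= p -> 0 <= a -> 0 <= b ->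
  (a + b) `^ p <= 2 `^ p * (a `^ p + b `^ p).
Proof.
(* With m the larger of a and b, (a + b)^p <= (2 m)^p, and m^p is one of a^p, b^p; this covers p < 1
   and p >= 1 alike. *)
move=> p0 a0 b0; pose m := Num.max a b.
have m0 : 0 <= m by rewrite le_max a0.
apply: (@le_trans _ _ ((2 * m) `^ p)).
  rewrite ge0_ler_powR ?nnegrE ?addr_ge0 ?mulr_ge0//.
  by rewrite mulr_natl mulr2n lerD// le_max lexx ?orbT.
rewrite powRM// ler_wpM2l ?powR_ge0// /m.
by case: (leP a b) => _; rewrite ?lerDl ?lerDr powR_ge0.
Qed.

(** Exponentiated, this is Bernoulli's inequality 1 + n x <= (1 + x)^n. *)
Lemma bernoulli_ln (R : realType) (n : nat) (x : R) : 0 <= x ->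
  ln (1 + n%:R * x) <= n%:R * ln (1 + x).
Proof.
move=> x0; have x1 : 0 < 1 + x by rewrite ltr_pwDl.
rewrite [leRHS]mulr_natl -lnXn// ler_ln ?posrE ?exprn_gt0 ?ltr_pwDl ?mulr_ge0//.
elim: n => [|n IH]; first by rewrite mul0r addr0.
rewrite exprS; apply: le_trans (ler_wpM2l (ltW x1) IH).
(* The product (1 + x)(1 + n x) exceeds 1 + (n + 1) x by exactly n x^2. *)
have := mulr_ge0 (ler0n R n) (sqr_ge0 x).
rewrite -natr1; nra.
Qed.

(** * Integrals of tails, truncations and dominated powers *)

Section integral.
Context d (T : measurableType d) (R : realType).
Context (mu : {measure set T -> \bar R}) (D : set T) (mD : measurable D).
Local Open Scope ereal_scope.

Lemma measurable_tail (g b : T -> R) (c : R) :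
  measurable_fun D g -> measurable_fun D b ->
  measurable_fun D (fun t => g t * (c < b t)%R%:R)%R.
Proof.
move=> mg mb; apply: measurable_funM => //.
rewrite (_ : (fun _ => _) = (fun t => if (c < b t)%R then 1%R else 0%R)).
  by apply: measurable_fun_if => //; exact: measurable_fun_ltr.
by apply/funext => t; case: ifP.
Qed.

Lemma measurable_le_indicator (b : T -> R) (c : R) : measurable_fun D b ->
  measurable_fun D (fun t => (b t <= c)%R%:R : R).
Proof.
move=> mb.
rewrite (_ : (fun _ => _) = (fun t => if (b t <= c)%R then 1%R else 0%R)).
  by apply: measurable_fun_if => //; exact: measurable_fun_ler.
by apply/funext => t; case: ifP.
Qed.

(** Dominated convergence with majorant g: at each point the indicator vanishes as soon as n >= b
    t. *)
Lemma cvg_integral_tail (g b : T -> R) :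
  measurable_fun D g -> measurable_fun D b -> (forall t, D t -> 0 <= g t)%R ->
  \int[mu]_(t in D) (g t)%:E < +oo ->
  \int[mu]_(t in D) (g t * (n%:R < b t)%R%:R)%:E @[n --> \oo] --> 0.
Proof.
move=> mg mb g0 goo; rewrite -(@integral0 _ _ _ mu D).
apply: (@dominated_cvg _ _ _ mu D mD _ _ (EFin \o g)) => //=.
- by move=> n; apply/measurable_EFinP; exact: measurable_tail.
- move=> t Dt; apply: cvg_near_cst; near=> n; congr (_%:E).
  rewrite [(_ < _)%R](_ : _ = false) ?mulr0//; apply/negbTE; rewrite -leNgt.
  by near: n; exact: nbhs_infty_ger.
- apply/integrableP; split; first exact/measurable_EFinP.
  rewrite (_ : integral _ _ _ = \int[mu]_(t in D) (g t)%:E)//.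
  by apply: eq_integral => t /set_mem Dt; rewrite /= ger0_norm ?g0.
- move=> n t Dt; rewrite lee_fin ger0_norm ?mulr_ge0 ?g0//.
  by rewrite ler_piMr ?g0// lern1 leq_b1.
Unshelve. all: by end_near. Qed.

(** Monotone convergence: the truncations increase with n and equal g at a given point from some n
    on. *)
Lemma integral_truncate_le (g b : T -> R) (c : \bar R) :
  measurable_fun D g -> measurable_fun D b -> (forall t, D t -> 0 <= g t)%R ->
  (forall n : nat, \int[mu]_(t in D) (g t * (b t <= n%:R)%R%:R)%:E <= c) ->
  \int[mu]_(t in D) (g t)%:E <= c.
Proof.
move=> mg mb g0 gc; pose g_ (n : nat) t := (g t * (b t <= n%:R)%R%:R)%:E.
have mg_ n : measurable_fun D (g_ n).
  apply/measurable_EFinP; apply: measurable_funM => //.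
  exact: measurable_le_indicator.
have g_0 n t : D t -> 0 <= g_ n t by move=> Dt; rewrite lee_fin mulr_ge0 ?g0.
have nd_g t : D t -> {homo g_^~ t : m n / (m <= n)%N >-> m <= n}.
  move=> Dt m n mn; rewrite lee_fin ler_wpM2l ?g0// ler_nat.
  case: (leP (b t) m%:R) => // bm.
  by rewrite (le_trans bm) ?ler_nat.
have gE : \int[mu]_(t in D) (g t)%:E =
    \int[mu]_(t in D) limn (g_^~ t).
  apply: eq_integral => t _; apply/esym/cvg_lim => //.
  apply: cvg_near_cst; near=> n; congr (_%:E).
  rewrite [(_ <= _)%R](_ : _ = true) ?mulr1//.
  by near: n; exact: nbhs_infty_ger.
have cvg_g : \int[mu]_(t in D) g_ n t @[n --> \oo] -->
    \int[mu]_(t in D) (g t)%:E.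
  by rewrite gE; exact: cvg_monotone_convergence.
rewrite -(cvg_lim _ cvg_g)//; apply: lime_le.
  by apply/cvg_ex; eexists; exact: cvg_g.
exact: nearW.
Unshelve. all: by end_near. Qed.

(** Integrate [powRD_le]; this replaces Minkowski's inequality, which fails for p < 1. *)
Lemma integral_powR_lty (p : R) (a b g : T -> R) : (0 <= p)%R ->
  measurable_fun D g -> measurable_fun D a -> measurable_fun D b ->
  \int[mu]_(t in D) (`|a t| `^ p)%:E < +oo ->
  \int[mu]_(t in D) (`|b t| `^ p)%:E < +oo ->
  {ae mu, forall t, D t -> (`|g t| <= `|a t| + `|b t|)%R} ->
  \int[mu]_(t in D) (`|g t| `^ p)%:E < +oo.
Proof.
move=> p0 mg ma mb aoo boo gab.
have mp (f : T -> R) : measurable_fun D f ->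
    measurable_fun D (fun t => (`|f t| `^ p)%:E).
  by move=> mf; apply/measurable_pow/measurableT_comp.
have ge0 (f : T -> R) t : 0 <= (`|f t| `^ p)%:E.
  by rewrite lee_fin powR_ge0.
apply: (@le_lt_trans _ _ (\int[mu]_(t in D)
    ((2 `^ p)%:E * ((`|a t| `^ p)%:E + (`|b t| `^ p)%:E)))).
  apply: ae_ge0_le_integral => //.
  - exact: mp.
  - by move=> t _; rewrite mule_ge0 ?adde_ge0 ?lee_fin ?powR_ge0.
  - by apply: measurable_funeM; apply: emeasurable_funD; exact: mp.
  apply: filterS gab => t + Dt => /(_ Dt) gab.
  rewrite -EFinD -EFinM lee_fin; apply: le_trans (powRD_le p0 _ _) => //.
  by rewrite ge0_ler_powR ?nnegrE ?addr_ge0.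
rewrite ge0_integralZl ?lee_fin ?powR_ge0//; first last.
- by move=> t _; rewrite adde_ge0.
- by apply: emeasurable_funD; exact: mp.
rewrite lte_mul_pinfty ?lee_fin ?powR_ge0//.
rewrite ge0_integralD//; [exact: lte_add_pinfty|exact: mp|exact: mp].
Qed.

End integral.

(** * Finite total mass, and membership of logarithms of ratios in L^p *)

Section circle.
Context (R : realType).
Local Open Scope ereal_scope.

Lemma dt2pi_circle_lty : dt2pi R (circle R) < +oo.
Proof.
rewrite /dt2pi /= /mscale /= lte_mul_pinfty ?lee_fin ?inv2pi_ge0//.
suff -> : @completed_lebesgue_measure R (circle R) =
    lebesgue_measure (circle R).
  by rewrite /circle lebesgue_measure_itv; case: ifP => //; rewrite ltry.
by [].
Qed.

End circle.

Section inLp.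
Context (R : realType).
Implicit Types (a b g : lebT R -> R) (p : R) (w : weight R).

Lemma inLp_le p a b g : 0 <= p -> measurable_fun (circle R) g ->
  inLp p a -> inLp p b ->
  {ae dt2pi R, forall t, circle R t -> `|g t| <= `|a t| + `|b t|} -> inLp p g.
Proof.
move=> p0 mg [ma aoo] [mb boo] gab; split; first exact: mg.
exact: (integral_powR_lty (@measurable_circle R) p0 mg ma mb aoo boo gab).
Qed.

Lemma inLp_cst p (c : R) : inLp p (fun=> c).
Proof.
split; first exact: measurable_cst.
rewrite integral_cst; last exact: measurable_circle.
by rewrite lte_mul_pinfty ?lee_fin ?powR_ge0 ?dt2pi_circle_lty.
Qed.

(** At x = 0 this rests on the conventions 0^-1 = 0 and ln 0 = 0, so log (w2 / w1) = - log (w1 / w2)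
    holds at every point of the circle, zeros of the weights included. *)
Lemma ln_inv (x : R) : 0 <= x -> ln x^-1 = - ln x.
Proof.
rewrite le_eqVlt => /predU1P[<-|x0]; last by rewrite lnV.
by rewrite invr0 ln0 ?oppr0.
Qed.

Lemma measurable_weightV w : measurable_fun (circle R) (fun t => (w t)^-1).
Proof.
apply: (eq_measurable_fun (fun t => w t `^ (-1))).
  by move=> t /set_mem Dt; rewrite powR_inv1// weight_ge0.
exact: (measurableT_comp (measurable_powR _) (weight_measurable w)).
Qed.

Lemma measurable_ratio w1 w2 :
  measurable_fun (circle R) (fun t => w1 t / w2 t).
Proof.
by apply: measurable_funM; [exact: weight_measurable|exact: measurable_weightV].
Qed.

Lemma ratio_ge0 w1 w2 t : circle R t -> 0 <= w1 t / w2 t.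
Proof. by move=> Dt; rewrite divr_ge0 ?weight_ge0. Qed.

(** The functions u and v of the overview are [logp_ratio w omega] and [logp_ratio omega w]. *)
Definition logp_ratio w1 w2 (t : lebT R) := Num.max (ln (w1 t / w2 t)) 0.

Lemma logp_ratio_ge0 w1 w2 t : 0 <= logp_ratio w1 w2 t.
Proof. by rewrite le_max lexx orbT. Qed.

Lemma measurable_logp_ratio w1 w2 :
  measurable_fun (circle R) (logp_ratio w1 w2).
Proof.
apply: measurable_maxr; last exact: measurable_cst.
exact: (measurableT_comp (@measurable_ln R) (measurable_ratio w1 w2)).
Qed.

(** Pointwise |log x| = log^+ x + log^+ (1 / x). *)
Lemma inLp_log_ratio p w1 w2 : 0 <= p ->
  inLp p (logp_ratio w1 w2) -> inLp p (logp_ratio w2 w1) ->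
  inLp p (fun t => ln (w1 t / w2 t)).
Proof.
move=> p0 h1 h2; apply: (inLp_le p0 _ h1 h2).
  exact: (measurableT_comp (@measurable_ln R) (measurable_ratio w1 w2)).
apply: aeW => t Dt; rewrite !(ger0_norm (logp_ratio_ge0 _ _ _)) /logp_ratio.
rewrite -[w2 t / w1 t]invf_div ln_inv ?ratio_ge0//.
set x := ln _; have [x0|x0] := leP 0 x.
  by rewrite ger0_norm// lerDl le_max lexx orbT.
by rewrite ltr0_norm// max_l ?lerDr// ?oppr_ge0 ltW.
Qed.

Lemma inLp_logp_ratioC p w1 w2 : 0 <= p ->
  inLp p (fun t => ln (w1 t / w2 t)) -> inLp p (logp_ratio w2 w1).
Proof.
(* Since log^+ (1 / x) <= |log x|, one majorant is enough; [h] fills both slots of [inLp_le]. *)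
move=> p0 h; apply: (inLp_le p0 (measurable_logp_ratio _ _) h h).
apply: aeW => t Dt; rewrite ger0_norm ?logp_ratio_ge0// /logp_ratio.
rewrite -[w2 t / w1 t]invf_div ln_inv ?ratio_ge0//.
by rewrite ge_max addr_ge0// andbT ler_wpDr// -normrN ler_norm.
Qed.

(** The product (1 + c x)(1 + 1 / c) = 1 + c x + 1 / c + x is at least max (x, 1), so log^+ x <= log
    (1 + c x) + log (1 + 1 / c), and constants lie in L^p. *)
Lemma inLp_logp_ratio_ln p w1 w2 (c : R) : 0 <= p -> 0 < c ->
  inLp p (fun t => ln (1 + c * (w1 t / w2 t))) -> inLp p (logp_ratio w1 w2).
Proof.
move=> p0 c0 h; apply: (inLp_le p0 (measurable_logp_ratio _ _) h
  (inLp_cst p (ln (1 + c^-1)))).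
apply: aeW => t Dt; rewrite (ger0_norm (logp_ratio_ge0 _ _ _)) /logp_ratio.
have := ratio_ge0 w1 w2 Dt; set x := w1 t / w2 t => x0.
have cx0 : 0 <= c * x by rewrite mulr_ge0// ltW.
have ci0 : 0 < c^-1 by rewrite invr_gt0.
rewrite !ger0_norm ?ln_ge0 ?lerDl// ?(ltW ci0)//.
rewrite -lnM ?posrE ?ltr_pwDl ?(ltW ci0)// ge_max; apply/andP; split.
  have [->|xn0] := eqVneq x 0.
    by rewrite ln0// ln_ge0// mulr0 addr0 mul1r lerDl ltW.
  have xp : 0 < x by rewrite lt_neqAle eq_sym xn0.
  rewrite ler_ln ?posrE// ?mulr_gt0 ?ltr_pwDl ?(ltW ci0)//.
  have ex : c * x * c^-1 = x by rewrite mulrAC divff ?mul1r ?gt_eqF.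
  by rewrite mulrDr mulr1 mulrDl mul1r ex; lra.
rewrite ln_ge0// mulrDl mul1r.
have := mulr_ge0 cx0 (ltW ci0); nra.
Qed.

End inLp.

(** * Modulus and measurability of complex functions *)

Section cmod.
Local Open Scope complex_scope.
Context (R : realType).

Lemma cmod_ge0 (z : R[i]) : 0 <= cmod z.
Proof. by rewrite /cmod normc_def sqrtr_ge0. Qed.

Lemma cmodB_le (x y : R[i]) : cmod (x - y) <= cmod x + cmod y.
Proof.
have := ler_normB x y.
by rewrite /cmod !normc_def -rmorphD/= lecR.
Qed.

Lemma cmod_real (x : R) : 0 <= x -> cmod x%:C = x.
Proof.
by move=> x0; rewrite /cmod normc_def/= expr0n addr0 sqrtr_sqr ger0_norm.
Qed.

Lemma cmeasurable_real (g : lebT R -> R) : measurable_fun (circle R) g ->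
  cmeasurable (fun t => (g t)%:C).
Proof. by move=> mg; split => //; exact: measurable_cst. Qed.

Lemma cmeasurable_sub (f g : lebT R -> R[i]) :
  cmeasurable f -> cmeasurable g -> cmeasurable (f \- g).
Proof.
move=> [mf1 mf2] [mg1 mg2]; split.
  apply: (eq_measurable_fun (fun t => complex.Re (f t) - complex.Re (g t))).
    by move=> t _ /=; case: (f t); case: (g t).
  exact: measurable_funB.
apply: (eq_measurable_fun (fun t => complex.Im (f t) - complex.Im (g t))).
  by move=> t _ /=; case: (f t); case: (g t).
exact: measurable_funB.
Qed.

Lemma measurable_cmod (f : lebT R -> R[i]) : cmeasurable f ->
  measurable_fun (circle R) (fun t => cmod (f t)).
Proof.
move=> [mf1 mf2]; apply: (eq_measurable_fun (fun t =>
    Num.sqrt (complex.Re (f t) ^+ 2 + complex.Im (f t) ^+ 2))).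
  by move=> t _; rewrite /cmod normc_def.
apply: (measurableT_comp (continuous_measurable_fun (@sqrt_continuous R))).
by apply: measurable_funD; exact: measurable_funX.
Qed.

End cmod.

(** * Comparison of the logarithmic norms for two weights *)

Section logw.
Context (R : realType).
Implicit Types (w omega : weight R) (f g : lebT R -> R[i]) (p : {posnum R}).

Lemma logw_ge0 w f t : circle R t -> 0 <= logw w f t.
Proof.
by move=> Dt; rewrite ln_ge0// lerDl mulr_ge0 ?cmod_ge0 ?weight_ge0.
Qed.

Lemma measurable_logw w f : cmeasurable f ->
  measurable_fun (circle R) (logw w f).
Proof.
move=> mf; apply: (measurableT_comp (@measurable_ln R)).
apply: measurable_funD; first exact: measurable_cst.
by apply: measurable_funM; [exact: measurable_cmod|exact: weight_measurable].
Qed.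

(** From 1 + a + b <= (1 + a)(1 + b) with a = |f| w and b = |g| w. *)
Lemma logwB_le w f g t : circle R t ->
  logw w (f \- g) t <= logw w f t + logw w g t.
Proof.
move=> Dt; rewrite /logw; have w0 := weight_ge0 w Dt.
have f0 := mulr_ge0 (cmod_ge0 (f t)) w0.
have g0 := mulr_ge0 (cmod_ge0 (g t)) w0.
rewrite -lnM ?posrE ?ltr_pwDl//.
rewrite ler_ln ?posrE ?mulr_gt0 ?ltr_pwDl ?mulr_ge0 ?cmod_ge0//.
have := ler_wpM2r w0 (cmodB_le (f t) (g t)); rewrite mulrDl /=.
by have := mulr_ge0 f0 g0; nra.
Qed.

(** With a = |f| omega and r = w / omega, 1 + a r <= (1 + a) max (r, 1). *)
Lemma logw_le_logp_ratio w omega f t : 0 < w t -> 0 < omega t ->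
  logw w f t <= logw omega f t + logp_ratio w omega t.
Proof.
move=> w0 o0; rewrite /logp_ratio /logw; have := cmod_ge0 (f t).
set c := cmod _ => c0; have co0 : 0 <= c * omega t by rewrite mulr_ge0// ltW.
have r0 : 0 < w t / omega t by rewrite divr_gt0.
have cw : c * w t = c * omega t * (w t / omega t).
  by rewrite -[RHS]mulrA [omega t * _]mulrC divfK ?gt_eqF.
have cw1 : 0 < 1 + c * w t by rewrite ltr_pwDl// mulr_ge0// ltW.
have co1 : 0 < 1 + c * omega t by rewrite ltr_pwDl.
have [r1|r1] := leP 1 (w t / omega t).
  rewrite max_l ?ln_ge0// -lnM// ler_ln ?posrE//; last exact: mulr_gt0.
  by rewrite cw mulrDl mul1r lerD2r.
rewrite max_r ?ln_le0 ?(ltW r1)// addr0 ler_ln// cw lerD2l.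
by rewrite ler_piMr// ltW.
Qed.

Lemma logw_le_mulrn w omega f t (n : nat) : circle R t -> 0 < omega t ->
  w t / omega t <= n%:R -> logw w f t <= n%:R * logw omega f t.
Proof.
move=> Dt o0 wn; have c0 := cmod_ge0 (f t).
have co0 : 0 <= cmod (f t) * omega t by rewrite mulr_ge0// ltW.
apply: le_trans (bernoulli_ln n co0).
rewrite ler_ln ?posrE ?ltr_pwDl ?mulr_ge0 ?weight_ge0// lerD2l.
by rewrite mulrCA ler_wpM2l// -ler_pdivrMr.
Qed.

Lemma weights_gt0 w omega :
  {ae dt2pi R, forall t, circle R t -> 0 < w t /\ 0 < omega t}.
Proof.
by apply: filterS2 (weight_gt0 w) (weight_gt0 omega) => t w0 o0 Dt;
  split; [exact: w0|exact: o0].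
Qed.

Lemma lognormp_lty p w f : cmeasurable f ->
  (lognormp p w f < +oo)%E <-> inLp p%:num (logw w f).
Proof.
move=> mf; rewrite unlock /inLp.
have -> : (\int[dt2pi R]_(t in circle R) (logw w f t `^ p%:num)%:E =
    \int[dt2pi R]_(t in circle R) (`|logw w f t| `^ p%:num)%:E)%E.
  apply: eq_integral => t /set_mem Dt.
  by rewrite (ger0_norm (logw_ge0 w f Dt)).
by split=> [h|[]//]; split=> //; exact: measurable_logw.
Qed.

Lemma lognormpB_lty p w f g : cmeasurable f -> cmeasurable g ->
  (lognormp p w f < +oo)%E -> (lognormp p w g < +oo)%E ->
  (lognormp p w (f \- g)%R < +oo)%E.
Proof.
move=> mf mg /(lognormp_lty _ _ mf) fp /(lognormp_lty _ _ mg) gp.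
have mfg := cmeasurable_sub mf mg.
apply/(lognormp_lty _ _ mfg).
apply: (inLp_le (ge0 p) (measurable_logw w mfg) fp gp).
apply: aeW => t Dt; rewrite !(ger0_norm (logw_ge0 _ _ Dt)).
exact: logwB_le.
Qed.

Lemma lognormp_change_lty p w omega f : cmeasurable f ->
  inLp p%:num (logp_ratio w omega) ->
  (lognormp p omega f < +oo)%E -> (lognormp p w f < +oo)%E.
Proof.
move=> mf hp /(lognormp_lty _ _ mf) fp; apply/(lognormp_lty _ _ mf).
apply: (inLp_le (ge0 p) (measurable_logw w mf) fp hp).
apply: filterS (weights_gt0 w omega) => t wo Dt; have [w0 o0] := wo Dt.
rewrite !(ger0_norm (logw_ge0 _ _ Dt)) (ger0_norm (logp_ratio_ge0 _ _ _)).
exact: logw_le_logp_ratio.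
Qed.

(** Merges the two pointwise bounds: Bernoulli where w / omega <= n, the additive bound with
    [powRD_le] elsewhere. The last term does not depend on f, and its integral can be made small by
    the choice of n. *)
Lemma logw_powR_le p w omega f t (n : nat) : circle R t ->
  0 < w t -> 0 < omega t ->
  logw w f t `^ p%:num <=
  (n%:R `^ p%:num + 2 `^ p%:num) * logw omega f t `^ p%:num +
  2 `^ p%:num * (logp_ratio w omega t `^ p%:num * (n%:R < w t / omega t)%R%:R).
Proof.
have p0 : 0 <= p%:num by [].
move=> Dt w0 o0; rewrite mulrDl.
have lo := logw_ge0 omega f Dt; have lw := logw_ge0 w f Dt.
have u0 := logp_ratio_ge0 w omega t.
have [wn|nw] := leP (w t / omega t) n%:R.
  rewrite !mulr0 addr0; apply: ler_wpDr; first by rewrite mulr_ge0 ?powR_ge0.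
  rewrite -powRM// ge0_ler_powR ?nnegrE ?mulr_ge0//.
  exact: logw_le_mulrn.
rewrite mulr1 -addrA -mulrDr; apply: ler_wpDl.
  by rewrite mulr_ge0 ?powR_ge0.
apply: (le_trans _ (powRD_le p0 lo u0)).
rewrite ge0_ler_powR ?nnegrE ?addr_ge0//.
exact: logw_le_logp_ratio.
Qed.

Lemma lognormp_change_small p w omega (e : R) :
  inLp p%:num (logp_ratio w omega) -> 0 < e ->
  exists2 d : R, 0 < d & forall f, cmeasurable f ->
    (lognormp p omega f < d%:E)%E -> (lognormp p w f < e%:E)%E.
Proof.
move=> [mu uoo] e0; pose C : R := 2 `^ p%:num.
have C0 : 0 < C by rewrite powR_gt0.
pose u t := logp_ratio w omega t `^ p%:num.
pose tail n t := u t * (n%:R < w t / omega t)%R%:R.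
have u_ge0 t : 0 <= u t by exact: powR_ge0.
have tail_ge0 n t : 0 <= tail n t by rewrite mulr_ge0.
have mup : measurable_fun (circle R) u.
  exact: (measurableT_comp (measurable_powR _) mu).
have uoo' : (\int[dt2pi R]_(t in circle R) (u t)%:E < +oo)%E.
  apply: le_lt_trans uoo; rewrite le_eqVlt; apply/orP; left; apply/eqP.
  by apply: eq_integral => t _; rewrite (ger0_norm (logp_ratio_ge0 _ _ _)).
have : (\int[dt2pi R]_(t in circle R) (tail n t)%:E @[n --> \oo] --> 0)%E.
  exact: (cvg_integral_tail (@measurable_circle R) mup
    (measurable_ratio w omega) _ uoo').
(* Each of the two terms of [logw_powR_le] gets e / 2: first n makes the tail integral less than e /
   (2 C), then d = e / (2 K) handles the term with coefficient K = n^p + C. *)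
have e2C : (0 < (e / 2 / C)%:E)%E by rewrite lte_fin !divr_gt0.
move=> /(_ _ (open_ereal_lt' e2C)) [n _ /(_ n (leqnn n))] tailn.
pose K : R := n%:R `^ p%:num + C.
have K0 : 0 < K by rewrite ltr_wpDl ?powR_ge0.
exists (e / 2 / K); first by rewrite !divr_gt0.
move=> f mf; rewrite unlock => fd.
have mp w' : measurable_fun (circle R) (fun t => (logw w' f t `^ p%:num)%:E).
  exact: (measurable_pow p%:num (measurable_logw w' mf)).
have mtail : measurable_fun (circle R) (fun t => (tail n t)%:E).
  apply/measurable_EFinP; exact: (measurable_tail (@measurable_circle R) _ mup
    (measurable_ratio w omega)).
apply: (@le_lt_trans _ _ (\int[dt2pi R]_(t in circle R)
    (K%:E * (logw omega f t `^ p%:num)%:E + C%:E * (tail n t)%:E))%E).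
  apply: ae_ge0_le_integral.
  - exact: measurable_circle.
  - by move=> t _; rewrite lee_fin powR_ge0.
  - exact: mp.
  - move=> t _; apply: adde_ge0.
      by rewrite mule_ge0 ?lee_fin ?(ltW K0) ?powR_ge0.
    by rewrite mule_ge0 ?lee_fin ?(ltW C0) ?tail_ge0.
  - apply: emeasurable_funD; apply: measurable_funeM; [exact: mp|exact: mtail].
  apply: filterS (weights_gt0 w omega) => t wo Dt; have [w0 o0] := wo Dt.
  by rewrite -!EFinM -EFinD lee_fin; exact: logw_powR_le.
rewrite ge0_integralD; first last.
- by apply: measurable_funeM; exact: mtail.
- by move=> t _; rewrite mule_ge0 ?lee_fin ?(ltW C0) ?tail_ge0.
- by apply: measurable_funeM; exact: mp.
- by move=> t _; rewrite mule_ge0 ?lee_fin ?(ltW K0) ?powR_ge0.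
- exact: measurable_circle.
rewrite ge0_integralZl; first last.
- by rewrite lee_fin ltW.
- by move=> t _; rewrite lee_fin powR_ge0.
- exact: mp.
- exact: measurable_circle.
rewrite ge0_integralZl; first last.
- by rewrite lee_fin ltW.
- by move=> t _; rewrite lee_fin tail_ge0.
- exact: mtail.
- exact: measurable_circle.
rewrite [e]splitr [ltRHS]EFinD; apply: lteD.
  by rewrite -lte_pdivlMl// -EFinM mulrC.
by rewrite -lte_pdivlMl// -EFinM mulrC.
Qed.

End logw.

(** * Passage from functions to classes, and from [rho] to [lognormp] *)

Section ae_class.
Context (R : realType).
Implicit Types (w : weight R) (f g : lebT R -> R[i]) (p : {posnum R}).

Definition class_of f (mf : cmeasurable f) : ae_class R :=
  (\pi_(ae_class R) (exist _ f (mem_set mf) : cfun R))%qT.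

Lemma rep_class_of f (mf : cmeasurable f) :
  {ae dt2pi R, forall t, circle R t -> rep (class_of mf) t = f t}.
Proof.
have /eqmodP/asboolP : (\pi_(ae_class R) (repr (class_of mf)) =
  \pi_(ae_class R) (exist _ f (mem_set mf) : cfun R))%qT by rewrite reprK.
by [].
Qed.

Lemma lognormp_class_of p w f (mf : cmeasurable f) :
  lognormp p w (rep (class_of mf)) = lognormp p w f.
Proof. exact: lognormp_pi. Qed.

Lemma lognormpB_class_of p w f g (mf : cmeasurable f) (mg : cmeasurable g) :
  lognormp p w (rep (class_of mf) \- rep (class_of mg)) =
  lognormp p w (f \- g).
Proof.
apply: lognormp_ae; [|exact: cmeasurable_sub|].
  exact: (cmeasurable_sub (rep_measurable _) (rep_measurable _)).
apply: filterS2 (rep_class_of mf) (rep_class_of mg) => t ft gt Dt /=.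
by rewrite ft// gt.
Qed.

(** The metric is [lognormp] raised to the power min (p, 1) / p, an increasing map whose inverse is
    applied to e. Membership of F and G keeps the norm finite, where [fine] loses nothing. *)
Lemma rho_ltE p w (F G : ae_class R) (e : R) : Llog p w F -> Llog p w G ->
  0 < e -> (rho p w F G < e) = (lognormp p w (rep F \- rep G)%R <
    (e `^ (p%:num / Num.min p%:num 1))%:E)%E.
Proof.
move=> wF wG e0.
have := lognormpB_lty (rep_measurable F) (rep_measurable G) wF wG.
have : (0 <= lognormp p w (rep F \- rep G)%R)%E.
  by rewrite unlock; apply: integral_ge0 => t _; rewrite lee_fin powR_ge0.
rewrite /rho /lognorm; case: lognormp => // x x0 _.
rewrite poweR_EFin /= -powRrM lte_fin; rewrite lee_fin in x0.
set m := Num.min _ _; have m0 : 0 < m by rewrite lt_min gt0 ltr01.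
have q0 : 0 < p%:num / m by rewrite divr_gt0.
have -> : p%:num^-1 * m = (p%:num / m)^-1 by rewrite invf_div mulrC.
rewrite -[in LHS](@powRr1 _ e) ?(ltW e0)// -(divff (lt0r_neq0 q0)) powRrM.
have mono a b : 0 <= a -> 0 <= b ->
    (a `^ (p%:num / m)^-1 < b `^ (p%:num / m)^-1) = (a < b).
  move=> a0 b0; have qi : 0 < (p%:num / m)^-1 by rewrite invr_gt0.
  have [ab|ba] := ltP a b.
    by rewrite gt0_ltr_powR// nnegrE.
  by apply/negbTE; rewrite -leNgt ge0_ler_powR// ?nnegrE// ltW.
by rewrite mono ?powR_ge0.
Qed.

End ae_class.

(** * Inclusion of the spaces and uniform continuity of the inclusion *)

Section continuity.
Context (R : realType).
Implicit Types (w omega : weight R) (p : {posnum R}).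

Lemma Llog_subset p w omega : inLp p%:num (logp_ratio w omega) ->
  Llog p omega `<=` Llog p w.
Proof.
by move=> h F; exact: (lognormp_change_lty (rep_measurable F) h).
Qed.

Lemma rho_change_small p w omega (e : R) :
  inLp p%:num (logp_ratio w omega) -> 0 < e ->
  exists2 d : R, 0 < d & forall F G, Llog p omega F -> Llog p omega G ->
    rho p omega F G < d -> rho p w F G < e.
Proof.
move=> h e0; pose q : R := p%:num / Num.min p%:num 1.
have q0 : 0 < q by rewrite divr_gt0// lt_min gt0 ltr01.
have [d d0 dP] := lognormp_change_small h (powR_gt0 q e0).
exists (d `^ q^-1); first by rewrite powR_gt0.
move=> F G oF oG; have [wF wG] := (Llog_subset h oF, Llog_subset h oG).
rewrite !rho_ltE ?powR_gt0// -/q -powRrM mulVf ?gt_eqF// powRr1 ?(ltW d0)//.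
exact/dP/cmeasurable_sub/rep_measurable/rep_measurable.
Qed.

(** Stated for arbitrary S and either order of the weights, so as to serve both for (ii) and for the
    reverse inclusion in (iv). *)
Lemma rho_topology_subset p w1 w2 (S : set (ae_class R))
    (S1 : S `<=` Llog p w1) (S2 : S `<=` Llog p w2) :
  inLp p%:num (logp_ratio w1 w2) -> rho_topology S1 `<=` rho_topology S2.
Proof.
move=> h U /rho_topologyP U1; apply/rho_topologyP => x /U1[e e0 eU].
have [d d0 dP] := rho_change_small h e0.
exists d => // y xy; apply: eU; apply: dP xy; exact/S2/set_valP.
Qed.

End continuity.

(** * The test functions c / w and their truncations *)

Section truncation.
Context (R : realType).
Implicit Types (w omega : weight R) (p : {posnum R}).
Local Open Scope complex_scope.

Definition cinv w (c : R) (t : lebT R) : R[i] := (c / w t)%:C.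

Definition cinv_trunc w omega (c : R) (n : nat) (t : lebT R) : R[i] :=
  (c / w t * (omega t / w t <= n%:R)%R%:R)%:C.

Lemma cinv_measurable w c : cmeasurable (cinv w c).
Proof.
apply: cmeasurable_real; apply: measurable_funM; first exact: measurable_cst.
exact: measurable_weightV.
Qed.

Lemma cinv_trunc_measurable w omega c n :
  cmeasurable (cinv_trunc w omega c n).
Proof.
apply: cmeasurable_real; apply: measurable_funM.
  apply: measurable_funM; first exact: measurable_cst.
  exact: measurable_weightV.
exact: (measurable_le_indicator (@measurable_circle R) _
  (measurable_ratio omega w)).
Qed.

Lemma logw_cinv w c t : 0 <= c -> 0 < w t ->
  logw w (cinv w c) t = ln (1 + c).
Proof.
move=> c0 w0; rewrite /logw cmod_real ?divr_ge0 ?(ltW w0)//.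
by rewrite divfK ?gt_eqF.
Qed.

Lemma logw_cinv_other w omega c t : 0 <= c -> 0 < w t ->
  logw omega (cinv w c) t = ln (1 + c * (omega t / w t)).
Proof.
move=> c0 w0; rewrite /logw cmod_real ?divr_ge0 ?(ltW w0)//.
by rewrite mulrAC mulrA.
Qed.

(** The indicator leaves the logarithm because ln (1 + 0) = 0. *)
Lemma logw_cinv_trunc w omega w' c n t :
  logw w' (cinv_trunc w omega c n) t =
  logw w' (cinv w c) t * (omega t / w t <= n%:R)%R%:R.
Proof.
rewrite /logw /cinv_trunc /cinv; case: (_ <= _)%R; first by rewrite !mulr1.
by rewrite !mulr0 cmod_real// mul0r addr0 ln1.
Qed.

Lemma logw_cinv_truncB w omega w' c n t :
  logw w' (cinv_trunc w omega c n \- cinv w c) t =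
  logw w' (cinv w c) t * (n%:R < omega t / w t)%R%:R.
Proof.
rewrite /logw /cinv_trunc /cinv /=; case: (leP (omega t / w t) n%:R) => _.
  by rewrite mulr1 subrr cmod_real// mul0r addr0 ln1 mulr0.
by rewrite !mulr0 sub0r mulr1 /cmod normrN.
Qed.

Lemma lognormp_le_cst p w f (k : R) : 0 <= k -> cmeasurable f ->
  {ae dt2pi R, forall t, circle R t -> logw w f t <= k} ->
  (lognormp p w f <= (k `^ p%:num)%:E * dt2pi R (circle R))%E.
Proof.
move=> k0 mf fk; rewrite -integral_cst; last exact: measurable_circle.
rewrite unlock; apply: ae_ge0_le_integral.
- exact: measurable_circle.
- by move=> t _; rewrite lee_fin powR_ge0.
- exact: (measurable_pow p%:num (measurable_logw w mf)).
- by move=> t _; rewrite lee_fin powR_ge0.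
- exact: measurable_cst.
apply: filterS fk => t + Dt => /(_ Dt) fk.
by rewrite lee_fin ge0_ler_powR// nnegrE logw_ge0.
Qed.

Lemma lognormp_cst_lty p w f (k : R) : 0 <= k -> cmeasurable f ->
  {ae dt2pi R, forall t, circle R t -> logw w f t <= k} ->
  (lognormp p w f < +oo)%E.
Proof.
move=> k0 mf fk; apply: (le_lt_trans (lognormp_le_cst p k0 mf fk)).
by rewrite lte_mul_pinfty ?lee_fin ?powR_ge0 ?dt2pi_circle_lty.
Qed.

Lemma cinv_lty p w c : 0 <= c -> (lognormp p w (cinv w c) < +oo)%E.
Proof.
move=> c0; apply: (@lognormp_cst_lty _ _ _ (ln (1 + c))).
- by rewrite ln_ge0// lerDl.
- exact: cinv_measurable.
by apply: filterS (weight_gt0 w) => t wt Dt; rewrite logw_cinv ?wt.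
Qed.

(** The bound is independent of n and tends to 0 with c; the topological converse depends on this
    uniformity. *)
Lemma cinv_trunc_le p w omega c n : 0 <= c ->
  (lognormp p w (cinv_trunc w omega c n) <=
   (ln (1 + c) `^ p%:num)%:E * dt2pi R (circle R))%E.
Proof.
move=> c0; have l0 : 0 <= ln (1 + c) by rewrite ln_ge0// lerDl.
apply: (lognormp_le_cst p l0 (cinv_trunc_measurable _ _ _ _)).
apply: filterS (weight_gt0 w) => t wt Dt.
rewrite logw_cinv_trunc logw_cinv ?wt//.
by case: (omega t / w t <= _)%R; rewrite ?mulr1 ?mulr0.
Qed.

(** Where the truncation is nonzero, omega / w <= n, so its [logw omega] is at most ln (1 + c n). *)
Lemma cinv_trunc_lty p w omega c n : 0 <= c ->
  (lognormp p omega (cinv_trunc w omega c n) < +oo)%E.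
Proof.
move=> c0; have cn0 : 0 <= c * n%:R by rewrite mulr_ge0.
have l0 : 0 <= ln (1 + c * n%:R) by rewrite ln_ge0// lerDl.
apply: (lognormp_cst_lty p l0 (cinv_trunc_measurable _ _ _ _)).
apply: filterS (weight_gt0 w) => t wt Dt.
rewrite logw_cinv_trunc logw_cinv_other ?wt//.
case: (leP (omega t / w t) n%:R) => rn; last by rewrite mulr0.
have cr0 := mulr_ge0 c0 (ratio_ge0 omega w Dt).
rewrite mulr1 ler_ln ?posrE ?ltr_pwDl//.
by rewrite lerD2l ler_wpM2l.
Qed.

Lemma inLp_logp_ratio_cinv p w omega c : 0 < c ->
  (lognormp p omega (cinv w c) < +oo)%E -> inLp p%:num (logp_ratio omega w).
Proof.
move=> c0 /(lognormp_lty _ _ (cinv_measurable w c)) h.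
apply: (inLp_logp_ratio_ln (ge0 p) c0).
apply: (inLp_le (ge0 p) _ h h).
  apply: (measurableT_comp (@measurable_ln R)).
  apply: measurable_funD; first exact: measurable_cst.
  apply: measurable_funM; first exact: measurable_cst.
  exact: measurable_ratio.
apply: filterS (weight_gt0 w) => t wt Dt.
by rewrite logw_cinv_other ?wt ?(ltW c0)// lerDl.
Qed.

Lemma lognormp_cinv_le p w omega c (k : \bar R) :
  (forall n, (lognormp p omega (cinv_trunc w omega c n) <= k)%E) ->
  (lognormp p omega (cinv w c) <= k)%E.
Proof.
rewrite unlock => h; have mc := measurable_logw omega (cinv_measurable w c).
apply: (integral_truncate_le (@measurable_circle R)
  (measurableT_comp (measurable_powR p%:num) mc) (measurable_ratio omega w)).
  by move=> t _; exact: powR_ge0.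
move=> n; apply: (le_trans _ (h n)); rewrite le_eqVlt; apply/orP; left.
apply/eqP; apply: eq_integral => t _; rewrite logw_cinv_trunc.
(* As p > 0, 0^p = 0, so the indicator also passes through the power. *)
by case: (_ <= _)%R; rewrite ?mulr1// !mulr0 powR0.
Qed.

Lemma cvg_cinv_trunc p w omega c : 0 <= c ->
  (lognormp p w (cinv_trunc w omega c n \- cinv w c)%R @[n --> \oo] --> 0)%E.
Proof.
move=> c0; have := cinv_lty p w c0; rewrite unlock => h.
have mc := measurable_logw w (cinv_measurable w c).
have := cvg_integral_tail (@measurable_circle R)
  (measurableT_comp (measurable_powR p%:num) mc) (measurable_ratio omega w)
  (fun t _ => powR_ge0 _ _) h.
apply: cvg_trans; apply: near_eq_cvg; apply: nearW => n.
apply: eq_integral => t _; rewrite logw_cinv_truncB.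
by case: (_ < _)%R; rewrite ?mulr1// !mulr0 powR0.
Qed.

End truncation.

(** A complete subspace is closed: a sequence of S converging to G is Cauchy, hence has a limit z in
    S, and the triangle inequality forces the distance from G to z to vanish. *)
Lemma rho_complete_closed (R : realType) (p : {posnum R}) (w : weight R)
    (S : set (ae_class R)) (Sw : S `<=` Llog p w) (x : nat -> ae_class R)
    (G : ae_class R) :
  rho_complete Sw -> (forall n, S (x n)) -> Llog p w G ->
  (forall e : R, 0 < e -> \forall n \near \oo, rho p w (x n) G < e) -> S G.
Proof.
move=> cS Sx wG xG.
pose y n : rho_space Sw := exist _ (x n) (mem_set (Sx n)).
have wx n : Llog p w (x n) by exact: (Sw _ (Sx n)).
have cy : cauchy (y @ \oo).
  apply: cauchy_exP => e e0; have e2 : 0 < e / 2 by rewrite divr_gt0.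
  have [N _ Ne] := xG _ e2; exists (y N); exists N => // n Nn /=.
  rewrite ballEmdist /=.
  apply: (le_lt_trans (rho_triangle (wx N) wG (wx n))).
  rewrite [ltRHS]splitr; apply: ltrD; first exact: (Ne N (leqnn N)).
  by rewrite rho_sym; exact: (Ne n Nn).
have [z yz] := cS _ _ cy.
suff -> : G = val z by exact: set_valP.
have wz : Llog p w (val z) by exact: (Sw _ (set_valP z)).
apply: (@rho_eq0 _ p w) => //; apply/eqP; rewrite eq_le; apply/andP; split.
  apply/ler_addgt0Pl => e e0; have e2 : 0 < e / 2 by rewrite divr_gt0.
  have /cvg_ballP/(_ _ e2) yze := yz.
  have [N [zN GN]] : exists n, rho p w (val z) (x n) < e / 2 /\
      rho p w (x n) G < e / 2.
    near \oo => n; exists n; split; last by near: n; exact: xG.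
    have : ball z (e / 2) (y n) by near: n; exact: yze.
    by rewrite ballEmdist.
  rewrite addr0; apply: (le_trans (rho_triangle wG (wx N) wz)).
  by rewrite [leRHS]splitr; apply: lerD; apply: ltW; rewrite rho_sym.
exact: powR_ge0.
Unshelve. all: by end_near. Qed.

(** * Recovering integrability of log^+ (omega / w) from equality, topology or completeness *)

Section converse.
Context (R : realType) (p : {posnum R}) (w omega : weight R).

Lemma Llog_cinv : Llog p w (class_of (cinv_measurable w 1)).
Proof. by rewrite /Llog /= lognormp_class_of; exact: cinv_lty. Qed.

Lemma inLp_logp_ratio_of_cinv :
  Llog p omega (class_of (cinv_measurable w 1)) ->
  inLp p%:num (logp_ratio omega w).
Proof.
by rewrite /Llog /= lognormp_class_of; exact: inLp_logp_ratio_cinv.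
Qed.

Lemma Llog_cinv_trunc c n : 0 <= c ->
  Llog p omega (class_of (cinv_trunc_measurable w omega c n)).
Proof.
by move=> c0; rewrite /Llog /= lognormp_class_of; exact: cinv_trunc_lty.
Qed.

Lemma exists_small_ln (k : \bar R) (e : R) : (0 <= k)%E -> (k < +oo)%E ->
  0 < e -> exists2 c : R, 0 < c & ((ln (1 + c) `^ p%:num)%:E * k < e%:E)%E.
Proof.
case: k => // k; rewrite lee_fin => k0 _ e0.
have k1 : 0 < k + 1 by rewrite ltr_wpDl.
have d0 : 0 < e / (k + 1) by rewrite divr_gt0.
(* As ln (1 + c) <= c, this c gives at most c^p k = e k / (k + 1) < e; the added 1 covers k = 0. *)
pose c := (e / (k + 1)) `^ p%:num^-1; have c0 : 0 < c by rewrite powR_gt0.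
exists c => //.
rewrite -EFinM lte_fin; apply: (@le_lt_trans _ _ (c `^ p%:num * k)).
  apply: ler_wpM2r => //.
  apply: ge0_ler_powR; rewrite ?nnegrE ?ln_ge0 ?lerDl ?(ltW c0)//.
  by apply: le_ln1Dx; rewrite (lt_trans _ c0)// ltrN10.
rewrite /c -powRrM mulVf ?gt_eqF// powRr1 ?(ltW d0)//.
by rewrite mulrAC ltr_pdivrMr// ltr_pM2l// ltrDl.
Qed.

(** The [rho p omega] unit ball about 0 contains a [rho p w] ball; for small c the latter contains
    all truncations of c / w, so their omega-norms are bounded and c / w itself lies in
    L^omega_p. *)
Lemma inLp_logp_ratio_of_topology (sub : Llog p omega `<=` Llog p w) :
  rho_topology (@subset_refl _ (Llog p omega)) `<=` rho_topology sub ->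
  inLp p%:num (logp_ratio omega w).
Proof.
move=> topS.
have mz : cmeasurable (fun=> 0 : R[i]) by split; exact: measurable_cst.
have zo : Llog p omega (class_of mz).
  rewrite /Llog /= lognormp_class_of.
  apply: (@lognormp_cst_lty _ p omega _ 0) => //.
  by apply: aeW => t _; rewrite /logw /cmod normr0 mul0r addr0 ln1.
pose Z : set_type (Llog p omega) := SigSub (mem_set zo).
pose U := [set x : set_type (Llog p omega) | rho p omega (val x) (val Z) < 1].
have oU : rho_topology (@subset_refl _ (Llog p omega)) U.
  apply/rho_topologyP => x Ux; exists (1 - rho p omega (val x) (val Z)).
    by rewrite subr_gt0.
  move=> y xy; have := rho_triangle (set_valP y) (set_valP x) (set_valP Z).
  by move=> /le_lt_trans; apply; rewrite -ltrBrDr rho_sym.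
have /rho_topologyP/(_ Z) [|e e0 eU] := topS _ oU.
  by rewrite /U /= rho_refl ltr01.
pose q : R := p%:num / Num.min p%:num 1.
have [c c0 cle] : exists2 c : R, 0 < c &
    ((ln (1 + c) `^ p%:num)%:E * dt2pi R (circle R) < (e `^ q)%:E)%E.
  apply: exists_small_ln; [exact: measure_ge0|exact: dt2pi_circle_lty|].
  exact: powR_gt0.
have f0 (f : lebT R -> R[i]) : f \- (fun=> 0) = f.
  by apply/funext => t /=; rewrite subr0.
(* The radius 1 of the ball U is the uniform bound passed to the limit by monotone convergence. *)
apply: (inLp_logp_ratio_cinv c0); apply: le_lt_trans (ltry 1).
apply: lognormp_cinv_le => n; rewrite -(f0 (cinv_trunc _ _ _ _)).
have to := Llog_cinv_trunc n (ltW c0).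
have := eU (SigSub (mem_set to)).
rewrite /U /= rho_sym rho_ltE//; [|exact: sub _ to|exact: sub _ zo].
rewrite rho_ltE// powR1 !lognormpB_class_of !f0 => tU.
apply/ltW/tU; apply: le_lt_trans cle; exact: cinv_trunc_le (ltW c0).
Qed.

(** The truncations of 1 / w lie in L^omega_p and converge to 1 / w for [rho p w], so closedness
    puts 1 / w in L^omega_p. *)
Lemma inLp_logp_ratio_of_complete (sub : Llog p omega `<=` Llog p w) :
  rho_complete sub -> inLp p%:num (logp_ratio omega w).
Proof.
move=> cS; apply: inLp_logp_ratio_of_cinv.
apply: (rho_complete_closed cS (fun n => Llog_cinv_trunc n ler01)
  Llog_cinv).
move=> e e0; pose q : R := p%:num / Num.min p%:num 1.
have eq0 : (0 < (e `^ q)%:E)%E by rewrite lte_fin powR_gt0.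
have := cvg_cinv_trunc p w omega ler01 => /(_ _ (open_ereal_lt' eq0)) [N _ Ne].
exists N => // n Nn /=.
rewrite rho_ltE//; [|exact: sub _ (Llog_cinv_trunc n ler01)|exact: Llog_cinv].
by rewrite lognormpB_class_of; exact: Ne.
Qed.

End converse.

(** * Assembly of the four statements *)

Unset Implicit Arguments.
Set Strict Implicit.

Theorem theorem6p3 (R : realType) (p : {posnum R}) (w omega : weight R)
  (hlog : inLp p%:num (fun t => Num.max (ln (w t / omega t)) 0)) :
  exists sub : Llog p omega `<=` Llog p w,
  [/\ (* (i) *)
      Llog p omega = Llog p w <-> inLp p%:num (fun t => ln (w t / omega t)),
      (* (ii) *)
      rho_topology sub `<=` rho_topology (@subset_refl _ (Llog p omega)),
      (* (iii) *)
      1 <= p%:num -> ~ inLp p%:num (fun t => ln (w t / omega t)) ->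
        Llog p omega `<` Llog p w /\
        rho_topology sub `<` rho_topology (@subset_refl _ (Llog p omega))
    & (* (iv) *)
      1 <= p%:num -> rho_complete sub ->
        [/\ inLp p%:num (fun t => ln (w t / omega t)),
            Llog p omega = Llog p w
          & rho_topology (@subset_refl _ (Llog p omega)) = rho_topology sub]].
Proof.
have p0 : 0 <= p%:num by [].
(* Given [hlog], the condition on log (w / omega) amounts to one on its negative part, log^+ (omega
   / w). *)
have lnC : inLp p%:num (logp_ratio omega w) <->
    inLp p%:num (fun t => ln (w t / omega t)).
  by split; [exact: inLp_log_ratio|exact: inLp_logp_ratioC].
have sub := Llog_subset hlog; exists sub.
have LlogE : inLp p%:num (logp_ratio omega w) -> Llog p omega = Llog p w.
  by move=> h; apply/seteqP; split=> //; exact: Llog_subset.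
have i : Llog p omega = Llog p w <-> inLp p%:num (fun t => ln (w t / omega t)).
  split=> [E|/lnC.2 h]; last exact: LlogE h.
  (* The class of 1 / w always lies in L^w_p, so equality of the spaces puts it in L^omega_p. *)
  apply: lnC.1; apply: inLp_logp_ratio_of_cinv.
  by rewrite E; exact: Llog_cinv.
have ii : rho_topology sub `<=` rho_topology (@subset_refl _ (Llog p omega)).
  exact: rho_topology_subset hlog.
split; [exact: i|exact: ii|move=> _ nL|move=> _ /inLp_logp_ratio_of_complete h].
  split.
    by rewrite properEneq; split; [apply/eqP => /i/nL|exact: sub].
  by split; [exact: ii|move=> /inLp_logp_ratio_of_topology/lnC/nL].
split; [exact: lnC.1 h|exact: LlogE h|].
apply/seteqP; split; last exact: ii.
exact: rho_topology_subset h.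
Qed.
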